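(* Let $M$ be a common meadow. If $z,z'\in 0\cdot M$ are such that $z\leq z'$, then the map $$f_{z,z'}:M_{z'}\to M_z,\qquad x\mapsto x+z$$ is a (well-defined, identity-preserving) ring homomorphism. Moreover, if $z,z',z''\in 0\cdot M$ are such that $z\leq z'\leq z''$, then $f_{z,z'}\circ f_{z',z''}=f_{z,z''}$.
   Context: A common meadow is a set $M$ with constants $0,1,\mathbf{a}$, binary operations $+,\cdot$ and unary operations $-$ and $(\cdot)^{-1}$ such that for all $x,y,z\in M$: $(x+y)+z=x+(y+z)$; $x+y=y+x$; $x+0=x$; $x+(-x)=0\cdot x$; $(x\cdot y)\cdot z=x\cdot(y\cdot z)$; $x\cdot y=y\cdot x$; $1\cdot x=x$; $x\cdot(y+z)=x\cdot y+x\cdot z$; $-(-x)=x$; $x\cdot x^{-1}=1+0\cdot x^{-1}$; $(x\cdot y)^{-1}=x^{-1}\cdot y^{-1}$; $(1+0\cdot x)^{-1}=1+0\cdot x$; $0^{-1}=\mathbf{a}$; $x+\mathbf{a}=\mathbf{a}$. Write $0\cdot M=\{0\cdot x\mid x\in M\}$, partially ordered by $z\leq z'$ iff $z\cdot z'=z$. For $z\in 0\cdot M$ let $M_z=\{x\in M\mid 0\cdot x=z\}$; with the restricted operations it is a commutative ring with zero $z$ and identity $1+z$ (possibly the zero ring). *)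

(* Defs.v *)
From HB Require Import structures.
From mathcomp Require Import all_boot all_order ssralg boolp.

Set Implicit Arguments.
Unset Strict Implicit.
Unset Printing Implicit Defensive.

Import Order.TTheory GRing.Theory.

Declare Scope meadow_scope.
Delimit Scope meadow_scope with CM.
Local Open Scope meadow_scope.

(* No MathComp algebraic structure is reused for the operations of M: a common
   meadow is not a ring, since neither x + (- x) = 0 nor 0 * x = 0 holds. *)
HB.mixin Record isCommonMeadow M of Choice M := {
  cm0 : M;
  cm1 : M;
  cma : M;
  cmadd : M -> M -> M;
  cmmul : M -> M -> M;
  cmopp : M -> M;
  cminv : M -> M;
  cmaddA : forall x y z, cmadd (cmadd x y) z = cmadd x (cmadd y z);
  cmaddC : forall x y, cmadd x y = cmadd y x;
  cmaddx0 : forall x, cmadd x cm0 = x;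
  cmaddxN : forall x, cmadd x (cmopp x) = cmmul cm0 x;
  cmmulA : forall x y z, cmmul (cmmul x y) z = cmmul x (cmmul y z);
  cmmulC : forall x y, cmmul x y = cmmul y x;
  cmmul1x : forall x, cmmul cm1 x = x;
  cmmulDr : forall x y z, cmmul x (cmadd y z) = cmadd (cmmul x y) (cmmul x z);
  cmoppK : forall x, cmopp (cmopp x) = x;
  cmmulxV : forall x, cmmul x (cminv x) = cmadd cm1 (cmmul cm0 (cminv x));
  cminvM : forall x y, cminv (cmmul x y) = cmmul (cminv x) (cminv y);
  cminv1D0 : forall x,
    cminv (cmadd cm1 (cmmul cm0 x)) = cmadd cm1 (cmmul cm0 x);
  cminv0 : cminv cm0 = cma;
  cmaddxa : forall x, cmadd x cma = cma;
}.

#[short(type="commonMeadowType")]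
HB.structure Definition CommonMeadow := {M of isCommonMeadow M & Choice M}.

Notation "0" := cm0 : meadow_scope.
Notation "1" := cm1 : meadow_scope.
Notation "x + y" := (cmadd x y) : meadow_scope.
Notation "x * y" := (cmmul x y) : meadow_scope.
Notation "- x" := (cmopp x) : meadow_scope.

Section CommonMeadowTheory.
Variable M : commonMeadowType.
Implicit Types x y z : M.

Lemma cmmulDl x y z : (x + y) * z = x * z + y * z.
Proof. by rewrite cmmulC cmmulDr !(cmmulC z). Qed.

Lemma cmadd0x x : 0 + x = x.
Proof. by rewrite cmaddC cmaddx0. Qed.

Lemma cmmulx1 x : x * 1 = x.
Proof. by rewrite cmmulC cmmul1x. Qed.

Lemma cmmul00 : 0 * 0 = 0 :> M.
Proof.
have e1 : 0 * - (1) = 0 :> M.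
  by rewrite -cmaddxN cmoppK cmaddC cmaddxN cmmulx1.
by rewrite -[X in 0 * X]cmmulx1 -(cmaddxN 1) cmmulDr e1 cmmulx1 cmaddx0.
Qed.

Lemma cmaddx0x x : x + 0 * x = x.
Proof. by rewrite -{1}(cmmul1x x) -cmmulDl cmaddx0 cmmul1x. Qed.

Lemma cmmul00x x : 0 * (0 * x) = 0 * x.
Proof. by rewrite -cmmulA cmmul00. Qed.

Lemma cmmul0M x y : 0 * (x * y) = (0 * x) * (0 * y).
Proof.
by rewrite [RHS]cmmulA -[x * (0 * y)]cmmulA
   (cmmulC x 0) [0 * x * y]cmmulA cmmul00x.
Qed.

Lemma cmmul0N x : 0 * - x = 0 * x.
Proof. by rewrite -cmaddxN cmoppK cmaddC cmaddxN. Qed.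

Lemma cm0idem x : (0 * x) * (0 * x) = 0 * x.
Proof.
set e := 0 * x.
have e0 : 0 * e = e by exact: cmmul00x.
have ee : e + e = e by rewrite -{2}e0 cmaddx0x.
have eM : e + e * e = e.
  pose u := 1 + e.
  have uu : u * u = u.
    have := cmmulxV u; rewrite cminv1D0 -/u => ->.
    by rewrite /u cmmulDr cmmulx1 e0 cmadd0x.
  have : 0 * (u * u) = 0 * u by rewrite uu.
  have -> : u * u = 1 + (e + e * e).
    by rewrite {1}/u cmmulDl cmmul1x /u cmmulDr cmmulx1 cmaddA -(cmaddA e) ee.
  by rewrite /u !cmmulDr !cmmulx1 !cmadd0x -cmmulA e0.
have eMe : e * (e + 0) = e * e + e by rewrite cmmulDr (cmmulC e 0) e0.
by rewrite cmaddx0 cmaddC eM in eMe.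
Qed.

End CommonMeadowTheory.

Section Zeros.
Variable M : commonMeadowType.

(* 0 . M; [asbool] makes the defining existential a boolean predicate. *)
Record zeros := Zeros {
  zeros_val :> M;
  zeros_subproof : `[< exists x : M, zeros_val = 0 * x >]
}.

HB.instance Definition _ := [isSub for zeros_val].
HB.instance Definition _ := [Choice of zeros by <:].

Lemma zerosP (z : zeros) : exists x : M, (z : M) = 0 * x.
Proof. exact/asboolP/zeros_subproof. Qed.

Lemma zeros0 (z : zeros) : 0 * (z : M) = z.
Proof. by have [x ->] := zerosP z; rewrite cmmul00x. Qed.

Definition zeros_le (z z' : zeros) := (z : M) * z' == (z : M).

Lemma zeros_idem (z : zeros) : (z : M) * z = z.
Proof. by have [x ->] := zerosP z; exact: cm0idem. Qed.

Lemma zeros_le_refl : reflexive zeros_le.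
Proof. by move=> z; apply/eqP/zeros_idem. Qed.

Lemma zeros_le_anti : antisymmetric zeros_le.
Proof.
move=> z z' /andP[/eqP zz' /eqP z'z]; apply: val_inj => /=.
by rewrite -zz' cmmulC.
Qed.

Lemma zeros_le_trans : transitive zeros_le.
Proof.
move=> y x z /eqP xy /eqP yz; apply/eqP.
by rewrite -[in LHS]xy cmmulA yz.
Qed.

Fact zeros_display : Order.disp_t. Proof. exact: (Order.Disp tt tt). Qed.

HB.instance Definition _ := Order.Le_isPOrder.Build zeros_display zeros
  zeros_le_refl zeros_le_anti zeros_le_trans.

End Zeros.

Section Layer.
Variables (M : commonMeadowType) (z : zeros M).

(* M_z for z in 0 . M. *)
Record layer := Layer {
  layer_val :> M;
  layer_subproof : 0 * layer_val == (z : M)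
}.

HB.instance Definition _ := [isSub for layer_val].
HB.instance Definition _ := [Choice of layer by <:].

Implicit Types x y : layer.

Lemma layerP x : 0 * (x : M) = z.
Proof. exact/eqP/layer_subproof. Qed.

Fact layer_zero_subproof : 0 * (z : M) == (z : M).
Proof. by rewrite zeros0. Qed.

Fact layer_one_subproof : 0 * (1 + (z : M)) == (z : M).
Proof. by rewrite cmmulDr cmmulx1 cmadd0x zeros0. Qed.

Fact layer_add_subproof x y : 0 * ((x : M) + (y : M)) == (z : M).
Proof. by rewrite cmmulDr !layerP -{2}(zeros0 z) cmaddx0x. Qed.

Fact layer_opp_subproof x : 0 * (- (x : M)) == (z : M).
Proof. by rewrite cmmul0N layerP. Qed.

Fact layer_mul_subproof x y : 0 * ((x : M) * (y : M)) == (z : M).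
Proof. by rewrite cmmul0M !layerP zeros_idem. Qed.

Definition layer_zero := Layer layer_zero_subproof.
Definition layer_one := Layer layer_one_subproof.
Definition layer_add x y := Layer (layer_add_subproof x y).
Definition layer_opp x := Layer (layer_opp_subproof x).
Definition layer_mul x y := Layer (layer_mul_subproof x y).

Fact layer_addA : associative layer_add.
Proof. by move=> x y t; apply: val_inj; rewrite /= cmaddA. Qed.

Fact layer_addC : commutative layer_add.
Proof. by move=> x y; apply: val_inj; rewrite /= cmaddC. Qed.

Fact layer_add0x : left_id layer_zero layer_add.
Proof.
by move=> x; apply: val_inj; rewrite /= cmaddC -(layerP x) cmaddx0x.
Qed.

Fact layer_addNx : left_inverse layer_zero layer_opp layer_add.
Proof. by move=> x; apply: val_inj; rewrite /= cmaddC cmaddxN layerP. Qed.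

HB.instance Definition _ := GRing.isZmodule.Build layer
  layer_addA layer_addC layer_add0x layer_addNx.

Fact layer_mulA : associative layer_mul.
Proof. by move=> x y t; apply: val_inj; rewrite /= cmmulA. Qed.

Fact layer_mulC : commutative layer_mul.
Proof. by move=> x y; apply: val_inj; rewrite /= cmmulC. Qed.

Fact layer_mul1x : left_id layer_one layer_mul.
Proof.
move=> x; apply: val_inj => /=; rewrite cmmulDl cmmul1x.
have -> : (z : M) * x = z.
  by rewrite -[in LHS](zeros0 z) cmmulA (cmmulC z) -cmmulA layerP zeros_idem.
by rewrite -(layerP x) cmaddx0x.
Qed.

Fact layer_mulDl : left_distributive layer_mul layer_add.
Proof. by move=> x y t; apply: val_inj; rewrite /= cmmulDl. Qed.

(* [comPzRingType], not [comNzRingType]: M_z may be the zero ring. *)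
HB.instance Definition _ := GRing.Zmodule_isComPzRing.Build layer
  layer_mulA layer_mulC layer_mul1x layer_mulDl.

End Layer.

(* [is_transition f] says that f is the map f_{z,z'} : x |-> x + z, the sum
   being taken in M; that such a map exists amounts to x + z lying in M_z for
   every x in M_z'. *)
Definition is_transition (M : commonMeadowType) (z z' : zeros M)
    (f : layer z' -> layer z) : Prop :=
  forall x : layer z', (f x : M) = (x : M) + (z : M).

(* Main.v *)
Require Import Defs.
From HB Require Import structures.
From mathcomp Require Import all_boot all_order ssralg.

(** On [0 * M] sum and product coincide, so [z <= z'] reads [z' + z = z]. This
    makes [x |-> x + z] land in [M_z], send zero to zero and one to one, and
    compose; together with the absorption [x * z = z] for [x] in [M_z'] it
    also makes the map multiplicative. *)

Set Implicit Arguments.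
Unset Strict Implicit.
Unset Printing Implicit Defensive.

Local Open Scope meadow_scope.

Lemma cm0_addxx (M : commonMeadowType) (x : M) : 0 * x + 0 * x = 0 * x.
Proof. by rewrite -{2}(cmmul00x x) cmaddx0x. Qed.

Lemma cm0D_mul (M : commonMeadowType) (x y : M) :
  0 * x + 0 * y = (0 * x) * (0 * y).
Proof.
(* With [e = 0 * u] and [f = 0 * v], the left side is [e * (1 + f)]. Since [e = 0 * e], the factor
   [0] can be moved onto [1 + f], and [0 * (1 + f) = f]. *)
have absorb (u v : M) : 0 * u + (0 * u) * (0 * v) = (0 * u) * (0 * v).
  rewrite -{1}[0 * u]cmmulx1 -cmmulDr -{1}(cmmul00x u) cmmulA.
  by rewrite (cmmulC (0 * u)) -cmmulA cmmulDr cmmulx1 cmadd0x cmmul00x cmmulC.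
(* The sum [0 * (x + y)] is itself idempotent; expand its square. *)
have := cm0idem (x + y); rewrite cmmulDr => <-.
rewrite cmmulDl !cmmulDr !cm0idem absorb (cmaddC (0 * y * _)) absorb.
by rewrite (cmmulC (0 * y)) -cmmul0M cm0_addxx.
Qed.

Lemma zeros_leD (M : commonMeadowType) (z z' : zeros M) :
  (z <= z')%O -> (z' : M) + z = z.
Proof.
move=> /eqP zz'; rewrite -(zeros0 z) -(zeros0 z') cm0D_mul !zeros0.
by rewrite cmmulC.
Qed.

Lemma zeros_addxx (M : commonMeadowType) (z : zeros M) : (z : M) + z = z.
Proof. by rewrite -(zeros0 z) cm0_addxx. Qed.

(** Writing [z] as [0 * z] lets the factor [0] move onto [x], which becomes [z']; what remains is
    the order hypothesis. *)
Lemma layer_mul_zeros (M : commonMeadowType) (z z' : zeros M) (x : layer z') :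
  (z <= z')%O -> (x : M) * z = z.
Proof.
move=> /eqP zz'.
by rewrite -{1}(zeros0 z) -cmmulA (cmmulC x) layerP cmmulC.
Qed.

Section Transition.
Variables (M : commonMeadowType) (z z' : zeros M) (le_zz' : (z <= z')%O).

(** Well-definedness: multiplication by [0] sends [x] to [z'] and fixes [z], leaving [z' + z]. *)
Fact transition_subproof (x : layer z') : 0 * ((x : M) + z) == (z : M).
Proof. by rewrite cmmulDr layerP zeros0 zeros_leD. Qed.

Definition transition (x : layer z') : layer z :=
  Layer (transition_subproof x).

Fact transition_is_nmod_morphism : GRing.nmod_morphism transition.
Proof.
split=> [|x y]; apply: val_inj => /=; first exact: zeros_leD.
by rewrite !cmaddA (cmaddC z) cmaddA zeros_addxx.
Qed.

Fact transition_is_monoid_morphism : GRing.monoid_morphism transition.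
Proof.
split=> [|x y]; apply: val_inj => /=; first by rewrite cmaddA zeros_leD.
(* Expanding [(x + z) * (y + z)] gives [x * y] and three further terms, each equal to [z], which
   collapse to one. *)
rewrite cmmulDl !cmmulDr zeros_idem (cmmulC z) !layer_mul_zeros //.
by rewrite zeros_addxx cmaddA zeros_addxx.
Qed.

HB.instance Definition _ := GRing.isNmodMorphism.Build (layer z') (layer z)
  transition transition_is_nmod_morphism.
HB.instance Definition _ := GRing.isMonoidMorphism.Build (layer z') (layer z)
  transition transition_is_monoid_morphism.

Definition transition_rmorphism : {rmorphism layer z' -> layer z} := transition.

End Transition.

Theorem proposition3p1 (M : commonMeadowType) :
  (forall z z' : zeros M, (z <= z')%O ->
     exists f : {rmorphism layer z' -> layer z}, is_transition f) /\
  (forall z z' z'' : zeros M, (z <= z')%O -> (z' <= z'')%O ->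
     forall (f : layer z' -> layer z) (g : layer z'' -> layer z')
            (h : layer z'' -> layer z),
       is_transition f -> is_transition g -> is_transition h ->
       f \o g =1 h).
Proof.
split=> [z z' le_zz'|z z' z'' le_zz' _ f g h fE gE hE x].
  by exists (transition_rmorphism le_zz').
(* Compared in [M], the composite is [(x + z') + z], and [z' + z = z]. *)
by apply: val_inj; rewrite /= fE gE hE cmaddA zeros_leD.
Qed.
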